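(* Let $k,d,\lambda$ be positive integers with $d\ge\lambda$ and $k\ge\lambda+1$, and suppose $\alpha(d,\lambda)\ge1$. Then $$m^*(k,d,\lambda)=\zeta(k,d,\lambda)=d-\lambda+k.$$ In particular, the vertex set of a cyclic polytope in $\mathbb{R}^d$ with at least $(d-\lambda+1)+k$ vertices does not have a complete Kneser $(d-\lambda)$-transversal to the convex hulls of its $k$-element subsets.
   Context: For a finite set $X\subset\mathbb{R}^d$, a $(d-\lambda)$-plane $L$ is a Kneser transversal of $X$ if $L$ intersects $\operatorname{conv}(K)$ for every $k$-element subset $K\subseteq X$; it is a complete Kneser $(d-\lambda)$-transversal if in addition $L$ contains $d-\lambda+1$ points of $X$. $m^*(k,d,\lambda)$ is the maximum positive integer $n$ such that every set of $n$ points (not necessarily in general position) in $\mathbb{R}^d$ has a complete Kneser $(d-\lambda)$-transversal to the convex hulls of its $k$-subsets. The moment curve is $\gamma(t)=(t,t^2,\ldots,t^d)$; a cyclic polytope with $n$ vertices is the convex hull of $\{\gamma(t_1),\ldots,\gamma(t_n)\}$ for reals $t_1<\cdots<t_n$ (its combinatorial/order type does not depend on the choice of the $t_i$). $\zeta(k,d,\lambda)$ is the maximum number of vertices a cyclic polytope in $\mathbb{R}^d$ can have so that its vertex set has a complete Kneser $(d-\lambda)$-transversal to the convex hulls of its $k$-subsets of vertices. $\alpha(d,\lambda)=\frac{\lambda-1}{\lceil d/2\rceil}$. *)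

(* Defs.v *)
From mathcomp Require Import all_boot all_order all_algebra finmap.
From mathcomp Require Import boolp classical_sets reals convex.
Set Implicit Arguments.
Unset Strict Implicit.
Unset Printing Implicit Defensive.

Import Order.TTheory GRing.Theory Num.Theory.

Local Open Scope classical_set_scope.
Local Open Scope ring_scope.

Definition conv_hull (R : realType) (d : nat) (A : set 'rV[R]_d) :
    set 'rV[R]_d :=
  smallest (@convex_set R 'rV[R]_d) A.

Definition is_flat (R : realType) (d m : nat) (L : set 'rV[R]_d) : Prop :=
  exists (p : 'rV[R]_d) (U : {vspace 'rV[R]_d}),
    \dim U = m /\ L = [set x | x - p \in U].

(* Here m is the dimension of the flat, i.e. m = d - lambda. *)
Definition kneser_transversal (R : realType) (d k m : nat)
    (X : {fset 'rV[R]_d}) (L : set 'rV[R]_d) : Prop :=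
  is_flat m L /\
  forall K : {fset 'rV[R]_d}, (K `<=` X)%fset -> #|` K| = k ->
    L `&` conv_hull [set` K] !=set0.

(* L may contain more than m + 1 points of X, which is possible when X is not
   in general position; the m + 1 points need not affinely span L. *)
Definition complete_kneser_transversal (R : realType) (d k m : nat)
    (X : {fset 'rV[R]_d}) (L : set 'rV[R]_d) : Prop :=
  kneser_transversal k m X L /\
  exists Y : {fset 'rV[R]_d},
    [/\ (Y `<=` X)%fset, #|` Y| = m.+1 & [set` Y] `<=` L].

Definition has_complete_kneser (R : realType) (d k m : nat)
    (X : {fset 'rV[R]_d}) : Prop :=
  exists L : set 'rV[R]_d, complete_kneser_transversal k m X L.

Definition moment_curve (R : realType) (d : nat) (t : R) : 'rV[R]_d :=
  \row_(i < d) t ^+ i.+1.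

Definition cyclic_polytope (R : realType) (d : nat) (P : set 'rV[R]_d) : Prop :=
  exists (n : nat) (t : 'I_n -> R),
    (forall i j : 'I_n, (i < j)%N -> t i < t j) /\
    P = conv_hull [set moment_curve d (t i) | i in [set: 'I_n]].

(* Vertices of a polytope, as its extreme points. *)
Definition vertices (R : realType) (d : nat) (P : set 'rV[R]_d) :
    set 'rV[R]_d :=
  [set x | P x /\
     forall (y z : 'rV[R]_d) (s : R), P y -> P z -> 0 < s < 1 ->
       x = s *: y + (1 - s) *: z -> y = x /\ z = x].

(* The largest positive element of A.  The value is 0 exactly when there is
   none, so that [max_pos A = n] with n positive asserts that the maximum
   exists and is n. *)
Definition max_pos (A : set nat) : nat :=
  let A' := [set n | (0 < n)%N /\ A n] in
  xget 0%N [set n | A' n /\ forall m, A' m -> (m <= n)%N].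

Definition mstar (R : realType) (k d lambda : nat) : nat :=
  max_pos [set n | forall X : {fset 'rV[R]_d}, #|` X| = n ->
                     has_complete_kneser k (d - lambda) X].

Definition zeta (R : realType) (k d lambda : nat) : nat :=
  max_pos [set n | exists (P : set 'rV[R]_d) (X : {fset 'rV[R]_d}),
                     [/\ cyclic_polytope P, vertices P = [set` X],
                         #|` X| = n & has_complete_kneser k (d - lambda) X]].

(* [uphalf d] is the ceiling of d / 2. *)
Definition alpha (d lambda : nat) : rat :=
  (lambda%:R - 1) / (uphalf d)%:R.

(* Main.v *)
(* Write m = d - lambda; the hypothesis on alpha says 2 (m + 1) <= d.
   Lower bound: among m + k points, an m-flat through m + 1 of them meets every
   k-subset, since only k - 1 points remain.
   Upper bound: if T is a set of m + 1 parameters, then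
   p(t) = prod_(a in T) (t - a)^2 has degree at most d, so it is the restriction
   to the moment curve of an affine form on R^d.  The m + 1 points of the curve
   with parameters in T are affinely independent, hence the form vanishes on
   every m-flat containing them, while it is positive on the convex hull of any
   other points of the curve. *)
Require Import Defs.
From mathcomp Require Import all_boot all_order all_algebra finmap.
From mathcomp Require Import boolp classical_sets reals convex.
From mathcomp Require Import interval_inference ring zify.
Set Implicit Arguments.
Unset Strict Implicit.
Unset Printing Implicit Defensive.

Import Order.TTheory GRing.Theory Num.Theory.

Local Open Scope classical_set_scope.
Local Open Scope ring_scope.

(** * Maxima, subspaces of prescribed dimension, finite subsets *)

Lemma max_posE (A : set nat) (n : nat) :
  (0 < n)%N -> A n -> (forall m, A m -> (m <= n)%N) -> max_pos A = n.
Proof.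
move=> n0 An An_max; rewrite /max_pos; apply: xget_unique => /=.
  by split=> // m [_ /An_max].
move=> m [[_ Am] m_max]; apply/eqP; rewrite eqn_leq An_max //.
by rewrite m_max.
Qed.

Lemma uphalf_le_alpha (d lambda : nat) :
  (0 < d)%N -> (0 < lambda)%N -> 1 <= alpha d lambda ->
  (uphalf d <= lambda.-1)%N.
Proof.
move=> d0 l0; rewrite /alpha ler_pdivlMr ?ltr0n; last by lia.
by rewrite mul1r -{1}(prednK l0) -natr1 addrK ler_nat.
Qed.

(** Adjoin to [V] the first [m - \dim V] vectors of a basis of a complement. This serves to build a
    flat of dimension exactly [m] through points that may be affinely dependent. *)
Lemma subvs_exists_dim (K : fieldType) (vT : vectType K) (V : {vspace vT})
    (m : nat) :
  (\dim V <= m <= \dim {: vT})%N ->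
  exists2 U : {vspace vT}, (V <= U)%VS & \dim U = m.
Proof.
case/andP=> Vm mT.
have dimVC : (\dim V + \dim V^C = \dim {: vT})%N.
  by rewrite -(addv_complf V) dimv_disjoint_sum // capv_compl.
pose B := take (m - \dim V) (vbasis V^C).
have sBV : (<<B>> <= V^C)%VS.
  by apply/span_subvP => v /mem_take/vbasis_mem.
exists (V + <<B>>)%VS; first exact: addvSl.
rewrite dimv_disjoint_sum; last first.
  by apply/eqP; rewrite -subv0 -(capv_compl V) capvS.
have /eqnP -> : free B.
  have := basis_free (vbasisP V^C).
  by rewrite -{1}(cat_take_drop (m - \dim V) (vbasis V^C)) => /catl_free.
rewrite size_take size_tuple; case: ltnP; lia.
Qed.

Lemma fsubset_card_exists (T : choiceType) (n : nat) (A : {fset T}) :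
  (n <= #|` A|)%N -> exists2 B : {fset T}, (B `<=` A)%fset & #|` B| = n.
Proof.
move=> nA; exists [fset x in take n (enum_fset A)]%fset.
  by apply/fsubsetP => x; rewrite !inE => /mem_take.
rewrite card_fseq undup_id ?take_uniq ?fset_uniq // size_take.
by case: ltngtP nA => // ->.
Qed.

(** * Convex hulls and their extreme points *)

Section ConvexHull.
Variables (R : realType) (d : nat).
Implicit Types (A C : set 'rV[R]_d) (x y : 'rV[R]_d).

Lemma convex_setP C :
  (forall x y (s : R), C x -> C y -> 0 < s < 1 -> C (s *: x + (1 - s) *: y)) ->
  @convex_set R 'rV[R]_d C.
Proof.
move=> Cconv; apply/convex_setW => x y; rewrite !inE => Cx Cy s s0 s1.
by rewrite inE; apply: Cconv => //; rewrite s0.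
Qed.

Lemma conv_hull_sub A C : @convex_set R 'rV[R]_d C -> A `<=` C ->
  conv_hull A `<=` C.
Proof. exact: smallest_sub. Qed.

Lemma conv_hull_gen A : A `<=` conv_hull A.
Proof. exact: sub_gen_smallest. Qed.

Lemma conv_hull_comb A x y (s : R) :
  conv_hull A x -> conv_hull A y -> 0 < s < 1 ->
  conv_hull A (s *: x + (1 - s) *: y).
Proof.
move=> Ax Ay /andP[s0 s1] C [Cconv AC].
have := Cconv x y (Itv01 (ltW s0) (ltW s1)).
by rewrite !inE; apply; [apply: Ax|apply: Ay].
Qed.

(* If x is an extreme point of the hull, then the hull minus x is convex. *)
Lemma vertices_conv_hull A : vertices (conv_hull A) `<=` A.
Proof.
move=> x [Ax xext]; apply: contrapT => nAx.
suff AA : conv_hull A `<=` conv_hull A `\ x by have [_ /(_ erefl)] := AA _ Ax.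
apply: conv_hull_sub; last first.
  move=> y Ay; split; first exact: conv_hull_gen.
  by move=> /= yx; apply: nAx; rewrite -yx.
apply: convex_setP => y z s [Ay yx] [Az zx] s01; split.
  exact: conv_hull_comb.
by move=> /= /esym/(xext _ _ _ Ay Az s01)[yx' _]; apply: yx.
Qed.

End ConvexHull.

(** * Polynomials as affine forms on the moment curve *)

Section MomentCurve.
Variables (R : realType) (d : nat).
Implicit Types (p : {poly R}) (x y : 'rV[R]_d) (a t : R) (s : seq R).

Definition moment_coef p : 'cV[R]_d := \col_(j < d) p`_j.+1.

(* The affine form on R^d that restricts to p along the moment curve, provided
   p has degree at most d. *)
Definition moment_form p x : R := p`_0 + (x *m moment_coef p) 0 0.

Lemma moment_form_curve p t :
  (size p <= d.+1)%N -> moment_form p (moment_curve d t) = p.[t].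
Proof.
move=> sp; rewrite (horner_coef_wide t sp) big_ord_recl expr0 mulr1.
congr (_ + _); rewrite mxE; apply: eq_bigr => j _.
by rewrite !mxE mulrC.
Qed.

Lemma moment_form_comb p x y (s : R) :
  moment_form p (s *: x + (1 - s) *: y) =
  s * moment_form p x + (1 - s) * moment_form p y.
Proof.
by rewrite /moment_form mulmxDl -!scalemxAl !mxE; ring.
Qed.

Lemma moment_form_coefB p x y :
  ((x - y) *m moment_coef p) 0 0 = moment_form p x - moment_form p y.
Proof. by rewrite /moment_form mulmxBl !mxE; ring. Qed.

(** The kernel of the linear part of the form consists of the directions along which the form is
    constant, so vanishing on a flat becomes an inclusion of subspaces. *)
Lemma memv_ker_moment p x y :
  (x - y \in lker (linfun (mulmxr (moment_coef p)))) =
  (moment_form p x == moment_form p y).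
Proof.
rewrite memv_ker lfunE /= -[RHS]subr_eq0 -moment_form_coefB.
apply/eqP/eqP => [->|xy0]; first by rewrite mxE.
by apply/matrixP => i j; rewrite !ord1 xy0 mxE.
Qed.

Lemma span_moment_ker p s b :
  (size p <= d.+1)%N -> all (root p) (b :: s) ->
  (<<[seq moment_curve d a - moment_curve d b | a <- s]>> <=
     lker (linfun (mulmxr (moment_coef p))))%VS.
Proof.
move=> sp /= /andP[/rootP pb /allP ps].
apply/span_subvP => _ /mapP[a /ps/rootP pa ->].
by rewrite memv_ker_moment !moment_form_curve // pa pb.
Qed.

(** Induction on [s]: the polynomial with simple roots [b :: s] gives a form whose linear part kills
    the differences coming from [s], but not the one coming from the new parameter [a], which is not
    a root. *)
Lemma free_moment_curve b s :
  uniq (b :: s) -> (size s <= d)%N ->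
  free [seq moment_curve d a - moment_curve d b | a <- s].
Proof.
elim: s => [|a s IHs]; first by rewrite nil_free.
rewrite /= inE negb_or -!andbA => /and4P[ba bs as_ us] sd.
rewrite free_cons IHs /= ?bs ?us ?(ltnW sd) // andbT.
pose p := \prod_(c <- b :: s) ('X - c%:P).
have sp : (size p <= d.+1)%N by rewrite size_prod_XsubC.
have ps : all (root p) (b :: s).
  by apply/allP => c cbs; rewrite root_prod_XsubC.
apply/negP => /(subvP (span_moment_ker sp ps)).
rewrite memv_ker_moment !moment_form_curve //.
have /andP[/rootP -> _] := ps.
rewrite -[_ == 0]/(root p a) root_prod_XsubC inE.
by rewrite eq_sym (negPf ba) (negPf as_).
Qed.

(** The [m] differences of curve points are free and lie in the [m]-dimensional direction space of
    [L], so they span it. The form is then constant on [L], with value 0 at a point of the curve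
    whose parameter is a root. *)
Lemma moment_form_flat0 p s m (L : set 'rV[R]_d) x :
  (size p <= d.+1)%N -> uniq s -> size s = m.+1 -> (m <= d)%N ->
  is_flat m L -> (forall a, a \in s -> L (moment_curve d a)) ->
  all (root p) s -> L x -> moment_form p x = 0.
Proof.
move=> sp; case: s => // b s us [sm] md [q [U [dimU ->]]] sL ps /= xU.
have bU : moment_curve d b - q \in U by apply: sL; rewrite mem_head.
have subU y : y - q \in U -> y - moment_curve d b \in U.
  by move=> yU; rewrite -(subrK q y) -addrA -(opprB _ q) rpredB.
have spanU : (<<[seq moment_curve d a - moment_curve d b | a <- s]>> = U)%VS.
  apply/eqP; rewrite eqEdim; apply/andP; split.
    apply/span_subvP => _ /mapP[a sa ->].
    by apply: subU; apply: sL; rewrite inE sa orbT.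
  have /eqnP -> : free [seq moment_curve d a - moment_curve d b | a <- s].
    by rewrite free_moment_curve // sm.
  by rewrite size_map sm dimU.
have /(subvP (span_moment_ker sp ps)) :
    x - moment_curve d b \in
      <<[seq moment_curve d a - moment_curve d b | a <- s]>>%VS.
  by rewrite spanU subU.
rewrite memv_ker_moment moment_form_curve // => /eqP ->.
by apply/rootP/(allP ps); rewrite mem_head.
Qed.

Lemma convex_moment_form_gt0 p :
  @convex_set R 'rV[R]_d [set x | 0 < moment_form p x].
Proof.
apply: convex_setP => x y s /= px py /andP[s0 s1].
by rewrite moment_form_comb addr_gt0 // mulr_gt0 // subr_gt0.
Qed.

Lemma seq_moment_curve (ys : seq 'rV[R]_d) :
  (forall y, y \in ys -> range (moment_curve d) y) ->
  exists s, ys = map (moment_curve d) s.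
Proof.
elim: ys => [|y ys IHys] ysP; first by exists [::].
have [t _ ty] := ysP _ (mem_head _ _).
have [|s ->] := IHys; first by move=> z zys; apply: ysP; rewrite inE zys orbT.
by exists (t :: s); rewrite /= ty.
Qed.

Lemma moment_curve_no_complete_kneser k m (X : {fset 'rV[R]_d}) :
  (m.+1.*2 <= d)%N -> [set` X] `<=` range (moment_curve d) ->
  (m.+1 + k <= #|` X|)%N -> ~ has_complete_kneser k m X.
Proof.
move=> md Xcurve Xk [L [[Lflat Ltrans] [Y [YX Ym YL]]]].
have [|s sY] := @seq_moment_curve (enum_fset Y).
  by move=> y yY; apply: Xcurve; apply: (fsubsetP YX).
have us : uniq s by have := fset_uniq Y; rewrite sY => /map_uniq.
have ss : size s = m.+1 by rewrite -Ym -(size_map (moment_curve d)) -sY.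
(* The subset that [L] misses is chosen disjoint from [Y]; the bound on the size of [X] leaves at
   least [k] points for it. *)
have [K KXY Kk] : exists2 K, (K `<=` X `\` Y)%fset & #|` K| = k.
  apply: fsubset_card_exists.
  by rewrite cardfsD (fsetIidPr YX) Ym; lia.
have [|x [Lx Kx]] := Ltrans K _ Kk.
  exact: fsubset_trans KXY (fsubsetDl _ _).
pose p : {poly R} := (\prod_(a <- s) ('X - a%:P)) ^+ 2.
have sp : (size p <= d.+1)%N.
  apply: leq_trans (size_poly_exp_leq _ _) _.
  by rewrite size_prod_XsubC ss /=; lia.
have p0 t : root p t = (t \in s).
  by rewrite /p (root_exp (mulrC _ _)) // root_prod_XsubC.
suff : 0 < moment_form p x.
  rewrite (moment_form_flat0 sp us ss _ Lflat _ _ Lx) ?ltxx //.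
  - lia.
  - move=> a sa; apply: YL.
    by rewrite /= -[_ \in Y]/(_ \in enum_fset Y) sY map_f.
  - by apply/allP => a; rewrite p0.
apply: (conv_hull_sub (convex_moment_form_gt0 (p := p)) _ Kx).
move=> y /= /(fsubsetP KXY); rewrite inE => /andP[yY yX].
have [t _ ty] := Xcurve _ yX.
(* The square gives nonnegativity; a zero would put [t] in [s], hence [y] in [Y]. *)
rewrite -ty moment_form_curve // lt_neqAle eq_sym -[_ == 0]/(root p t) p0.
apply/andP; split.
  by apply: contra yY => st; rewrite -ty -[_ \in Y]/(_ \in enum_fset Y) sY map_f.
by rewrite horner_exp sqr_ge0.
Qed.

(** The form of [('X - (t i)%:P) ^+ 2] defines a supporting hyperplane that touches the curve only
    at parameter [t i]; its degree 2 is why [1 < d] is assumed. *)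
Lemma vertices_cyclic_polytope n (t : 'I_n -> R) :
  (1 < d)%N ->
  vertices (conv_hull [set moment_curve d (t i) | i in [set: 'I_n]]) =
  [set moment_curve d (t i) | i in [set: 'I_n]].
Proof.
move=> d1; apply/seteqP; split; first exact: vertices_conv_hull.
move=> _ [i _ <-]; set P := conv_hull _.
pose p : {poly R} := ('X - (t i)%:P) ^+ 2.
have sp : (size p <= d.+1)%N by rewrite size_exp_XsubC.
have pE a : moment_form p (moment_curve d a) = (a - t i) ^+ 2.
  by rewrite moment_form_curve // horner_exp hornerXsubC.
have pi0 : moment_form p (moment_curve d (t i)) = 0 by rewrite pE subrr expr0n.
(* This set is convex and contains the generators, so the hull meets the hyperplane only at the
   chosen point. *)
have PP : P `<=` [set x | 0 < moment_form p x \/ x = moment_curve d (t i)].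
  apply: conv_hull_sub => [|_ [j _ <-]]; last first.
    have [<-|tij] := eqVneq (t i) (t j); [by right|left].
    by rewrite pE exprn_even_gt0 //= subr_eq0 eq_sym.
  apply: convex_setP => x y s /= px py /andP[s0 s1].
  have s1' : 0 < 1 - s by rewrite subr_gt0.
  rewrite moment_form_comb.
  case: px py => [px|->] [py|->]; rewrite ?pi0.
  - by left; rewrite addr_gt0 // mulr_gt0.
  - by left; rewrite mulr0 addr0 mulr_gt0.
  - by left; rewrite mulr0 add0r mulr_gt0.
  - by right; rewrite -scalerDl addrC subrK scale1r.
split; first by apply: conv_hull_gen; exists i.
move=> y z s /PP Py /PP Pz /andP[s0 s1] /(congr1 (moment_form p)).
have s1' : 0 < 1 - s by rewrite subr_gt0.
rewrite moment_form_comb pi0.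
(* The combination has value 0, so neither [y] nor [z] can have a positive one. *)
case: Py Pz => [py|->] [pz|->] //; rewrite ?pi0 ?mulr0 ?addr0 ?add0r => /esym/eqP.
- by rewrite gt_eqF // addr_gt0 // mulr_gt0.
- by rewrite gt_eqF // mulr_gt0.
- by rewrite gt_eqF // mulr_gt0.
Qed.

Lemma moment_curve_inj : (0 < d)%N -> injective (moment_curve d : R -> _).
Proof.
by move=> d0 a b /rowP/(_ (Ordinal d0)); rewrite !mxE !expr1.
Qed.

End MomentCurve.

(** * Extremal point sets and the two bounds *)

Lemma moment_curve_fset (R : realType) (d n : nat) : (0 < d)%N ->
  exists2 X : {fset 'rV[R]_d}, #|` X| = n &
    [set` X] = [set moment_curve d (i%:R : R) | i in [set: 'I_n]].
Proof.
move=> d0.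
pose s := [seq moment_curve d (i%:R : R) | i : 'I_n].
have us : uniq s.
  rewrite map_inj_uniq ?enum_uniq // => i j /(moment_curve_inj d0)/eqP.
  by rewrite eqr_nat => /eqP/val_inj.
exists [fset x in s]%fset.
  by rewrite card_fseq undup_id // size_image card_ord.
apply/seteqP; split => x /=; rewrite inE.
  by move=> /mapP[i _ ->]; exists i.
by move=> [i _ <-]; apply/mapP; exists i; rewrite ?mem_enum.
Qed.

Lemma has_complete_kneser_card (R : realType) (d k m : nat)
    (X : {fset 'rV[R]_d}) :
  (0 < k)%N -> (m <= d)%N -> #|` X| = (m + k)%N -> has_complete_kneser k m X.
Proof.
move=> k0 md Xmk.
have [Y YX Ym] : exists2 Y, (Y `<=` X)%fset & #|` Y| = m.+1.
  by apply: fsubset_card_exists; lia.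
have [y yY] : exists y, y \in Y by apply/fset0Pn; rewrite -cardfs_gt0 Ym.
pose V := <<[seq z - y | z <- enum_fset (Y `\ y)%fset]>>%VS.
(* [V] has dimension less than [m] when the points of [Y] are affinely dependent, hence the
   enlargement to [U]. *)
have [|U VU dimU] := @subvs_exists_dim _ _ V m.
  rewrite dimvf /dim /= mul1n md andbT (leq_trans (dim_span _)) // size_map.
  by have := cardfsD1 y Y; rewrite yY Ym => -[->].
have YU z : z \in Y -> z - y \in U.
  move=> zY; have [->|zy] := eqVneq z y; first by rewrite subrr mem0v.
  apply/(subvP VU)/memv_span/mapP; exists z => //.
  by rewrite !inE zy.
exists [set x | x - y \in U]; split; last by exists Y; split.
split; first by exists y, U.
move=> K KX Kk.
(* If [K] and [Y] were disjoint, their union would have [m + 1 + k] points, one more than [X]. *)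
have [z] : exists z, z \in (K `&` Y)%fset.
  apply/fset0Pn/negP => /eqP KY0.
  have := fsubset_leq_card (_ : K `|` Y `<=` X)%fset.
  rewrite cardfsU KY0 cardfs0 Kk Ym Xmk fsubUset KX YX => /(_ isT); lia.
rewrite inE => /andP[zK zY]; exists z; split; first exact: YU.
exact: conv_hull_gen.
Qed.

Theorem theorem2 (R : realType) (k d lambda : nat)
    (hk : (0 < k)%N) (hd : (0 < d)%N) (hlambda : (0 < lambda)%N)
    (hdl : (lambda <= d)%N) (hkl : (lambda + 1 <= k)%N)
    (halpha : 1 <= alpha d lambda) :
  [/\ mstar R k d lambda = zeta R k d lambda,
      zeta R k d lambda = (d - lambda + k)%N &
      forall (P : set 'rV[R]_d) (X : {fset 'rV[R]_d}),
        cyclic_polytope P -> vertices P = [set` X] ->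
        (d - lambda + 1 + k <= #|` X|)%N ->
        ~ has_complete_kneser k (d - lambda) X].
Proof.
have dl := uphalf_le_alpha hd hlambda halpha.
(* From [uphalf d <= lambda - 1] one gets [d - lambda + 1 <= d - uphalf d], which is the floor of
   [d / 2]. *)
have md : ((d - lambda).+1.*2 <= d)%N by lia.
have upper (P : set 'rV[R]_d) (X : {fset 'rV[R]_d}) :
    cyclic_polytope P -> vertices P = [set` X] ->
    (d - lambda + 1 + k <= #|` X|)%N -> ~ has_complete_kneser k (d - lambda) X.
  move=> [n [t [_ ->]]] vX Xk.
  apply: moment_curve_no_complete_kneser => //; last by rewrite -addn1.
  rewrite -vX; apply: subset_trans (@vertices_conv_hull _ _ _) _.
  by move=> _ [i _ <-]; exists (t i).
have zetaE : zeta R k d lambda = (d - lambda + k)%N.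
  apply: max_posE; first by lia.
    have [X Xn XE] := @moment_curve_fset R d (d - lambda + k) hd.
    exists (conv_hull [set` X]), X; split=> //.
    - exists (d - lambda + k)%N, (fun i => i%:R); rewrite XE; split=> // i j ij.
      by rewrite ltr_nat.
    (* Here [1 < d] comes from [md], whose left side is at least 2. *)
    - by rewrite XE vertices_cyclic_polytope //; lia.
    - by apply: has_complete_kneser_card => //; lia.
  move=> n [P [X [Pcyc vX Xn Xhas]]].
  by rewrite leqNgt; apply/negP => nlt; apply: (upper P X) => //; lia.
split=> //; rewrite zetaE; apply: max_posE; first by lia.
  by move=> X Xn; apply: has_complete_kneser_card => //; lia.
(* Every larger [n] is excluded by a single set of that size: the curve points with parameters 0,
   ..., [n - 1]. *)
move=> n nhas; rewrite leqNgt; apply/negP => nlt.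
have [X Xn XE] := @moment_curve_fset R d n hd.
apply: moment_curve_no_complete_kneser md _ _ (nhas X Xn).
  by rewrite XE => _ [i _ <-]; exists (i%:R).
by lia.
Qed.
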